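(* Let $T$ be a distributive lattice. The space $\mathrm{Jspec}(T)$ is a spectral subspace of $\mathrm{Spec}(T)$ canonically homeomorphic to $\mathrm{Spec}(\mathrm{He}(T))$. More precisely, writing $M=\mathrm{Max}(T)$, for all $a,b\in T$: $$D_T(a)\cap M\subseteq D_T(b)\cap M\quad\Longleftrightarrow\quad a\preceq_{\mathrm{He}(T)} b .$$
   Context: This is a result of classical mathematics. Distributive lattices have a least element $0$ and a greatest element $1$; morphisms preserve $0,1,\wedge,\vee$. An ideal of $T$ is a subset containing $0$, closed under $\vee$ and downward closed; a filter is defined by reversing the order. A prime ideal is an ideal whose complement is a filter; a maximal ideal is a maximal proper ideal. $\mathrm{Spec}(T)$ is the set of prime ideals of $T$ with the topology having as basis of open sets $D_T(a)=\{\mathfrak p\in \mathrm{Spec}(T): a\notin\mathfrak p\}$ ($a\in T$). A space homeomorphic to some $\mathrm{Spec}(T)$ is called spectral. The constructible (patch) topology on $\mathrm{Spec}(T)$ is the one having as basis the sets $D_T(a)\cap V_T(b)$, where $V_T(b)=\mathrm{Spec}(T)\setminus D_T(b)$. A quotient lattice $\pi:T\to T'$ (a surjective morphism) induces an injection $\pi^\star:\mathrm{Spec}(T')\to \mathrm{Spec}(T)$, $\mathfrak q\mapsto \pi^{-1}(\mathfrak q)$; a subset of $\mathrm{Spec}(T)$ of the form $\pi^\star(\mathrm{Spec}(T'))$, with the induced topology, is called a spectral subspace of $\mathrm{Spec}(T)$. $\mathrm{Max}(T)\subseteq\mathrm{Spec}(T)$ is the set of maximal ideals of $T$, and $\mathrm{Jspec}(T)$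 is the closure of $\mathrm{Max}(T)$ in $\mathrm{Spec}(T)$ for the constructible topology; it is endowed with the topology induced by (the usual topology of) $\mathrm{Spec}(T)$. For $b\in T$, $J_T(b)=\{a\in T:\forall x\in T\ (a\vee x=1\Rightarrow b\vee x=1)\}$. The Heitmann lattice $\mathrm{He}(T)$ is the quotient lattice of $T$ defined by the preorder $a\preceq_{\mathrm{He}(T)}b$ iff $J_T(a)\subseteq J_T(b)$ (two elements are identified when each is $\preceq$ the other); equivalently $a\in J_T(b)$. *)

(* Defs.v *)
From HB Require Import structures.
From mathcomp Require Import all_boot all_order.
From mathcomp Require Import all_classical topology.

Set Implicit Arguments.
Unset Strict Implicit.
Unset Printing Implicit Defensive.

Import Order.TTheory.

Local Open Scope order_scope.
Local Open Scope classical_set_scope.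
Local Open Scope quotient_scope.

(* Distributive lattices with 0 and 1 are [tbDistrLatticeType]s; the trivial
   lattice, where [\bot = \top], is allowed. *)

(* The order library's [TBLatticeMorphism] only asks for the preservation of
   [\bot] and [\top]; the join below also asks for that of meets and joins. *)
#[short(type="tbdlMorphism")]
HB.structure Definition TBDLMorphism d (T : tbDistrLatticeType d)
    d' (T' : tbDistrLatticeType d') :=
  {f of @Order.LatticeMorphism d T d' T' f
      & @Order.TBLatticeMorphism d T d' T' f}.

Section Ideals.
Context {d : Order.disp_t} {T : tbDistrLatticeType d}.
Implicit Types I F : set T.

Definition lattice_ideal I : Prop :=
  [/\ I \bot,
      forall a b, I a -> I b -> I (a `|` b)%O &
      forall a b, a <= b -> I b -> I a].

Definition lattice_filter F : Prop :=
  [/\ F \top,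
      forall a b, F a -> F b -> F (a `&` b)%O &
      forall a b, b <= a -> F b -> F a].

Definition prime_ideal I : Prop := lattice_ideal I /\ lattice_filter (~` I).

Definition proper_ideal I : Prop := lattice_ideal I /\ I <> setT.

Definition maximal_ideal I : Prop :=
  proper_ideal I /\ forall I', proper_ideal I' -> I `<=` I' -> I' = I.

End Ideals.

Record Spec (d : Order.disp_t) (T : tbDistrLatticeType d) : Type := MkSpec {
  spec_ideal : set T;
  spec_prime : prime_ideal spec_ideal }.

Section SpecTheory.
Context {d : Order.disp_t} {T : tbDistrLatticeType d}.

Definition specD (a : T) : set (Spec T) := [set p | ~ spec_ideal p a].
Definition specV (a : T) : set (Spec T) := ~` specD a.

Lemma spec_eq (p q : Spec T) : spec_ideal p = spec_ideal q -> p = q.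
Proof.
case: p q => [p hp] [q hq] /= pq; subst q.
by rewrite (Prop_irrelevance hp hq).
Qed.

Lemma specDT : specD \top = setT.
Proof. by apply/seteqP; split=> // p _; case: (spec_prime p) => _ []. Qed.

Lemma specD0 : specD \bot = set0.
Proof. by apply/seteqP; split=> // p; case: (spec_prime p) => -[p0 _ _] _ []. Qed.

Lemma specDI (a b : T) : specD (a `&` b)%O = specD a `&` specD b.
Proof.
apply/seteqP; split=> p; case: (spec_prime p) => -[_ _ dw] [_ mt _].
  by move=> nab; split=> h; apply: nab; apply: dw h; rewrite ?leIl ?leIr.
by case; exact: mt.
Qed.

Lemma specDU (a b : T) : specD (a `|` b)%O = specD a `|` specD b.
Proof.
apply/seteqP; split=> p; case: (spec_prime p) => -[_ jn dw] _.
  move=> nab; have [pa|] := pselect (spec_ideal p a); last by left.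
  have [pb|] := pselect (spec_ideal p b); last by right.
  by case: nab; exact: jn.
by case=> h pab; apply: h; apply: dw pab; rewrite ?leUl ?leUr.
Qed.

End SpecTheory.

(* The topology with basis [b]: the opens are the unions of sets [b i]. *)
Definition open_of_basis (I X : Type) (b : I -> set X) : set_system X :=
  [set U | forall x, U x -> exists i, b i x /\ b i `<=` U].

Section OpenOfBasis.
Context {I X : Type} (b : I -> set X).
Hypothesis b_cover : forall x, exists i, b i x.
Hypothesis b_meet : forall i j, exists k, b k = b i `&` b j.

Lemma open_of_basisT : open_of_basis b setT.
Proof. by move=> x _; have [i bix] := b_cover x; exists i. Qed.

Lemma open_of_basisI : setI_closed (open_of_basis b).
Proof.
move=> U V oU oV x [/oU[i [bix biU]] /oV[j [bjx bjV]]].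
have [k bk] := b_meet i j; exists k; rewrite bk; split=> //.
by move=> y [/biU ? /bjV].
Qed.

Lemma open_of_basis_bigU (J : Type) (f : J -> set X) :
  (forall j, open_of_basis b (f j)) -> open_of_basis b (\bigcup_j f j).
Proof.
move=> of_ x [j _ /of_[i [bix bif]]]; exists i; split=> //.
by move=> y /bif; exists j.
Qed.

End OpenOfBasis.

Section SpecTopology.
Context {d : Order.disp_t} {T : tbDistrLatticeType d}.

Lemma specD_cover (p : Spec T) : exists a, specD a p.
Proof. by exists \top; rewrite specDT. Qed.

Lemma specD_meet (a b : T) : exists c, specD c = specD a `&` specD b.
Proof. by exists (a `&` b)%O; rewrite specDI. Qed.

HB.instance Definition _ := gen_eqMixin (Spec T).
HB.instance Definition _ := gen_choiceMixin (Spec T).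
HB.instance Definition _ := isOpenTopological.Build (Spec T)
  (open_of_basisT specD_cover) (open_of_basisI specD_meet)
  (@open_of_basis_bigU _ _ specD).

Lemma open_specD : @open (Spec T) = open_of_basis specD.
Proof. by []. Qed.

Lemma specD_basis : basis (range (@specD d T)).
Proof.
split=> [_ [a _ <-]|p U]; first by rewrite open_specD => p ap; exists a; split=> // q.
rewrite nbhsE => -[V [+ Vp] VU]; rewrite open_specD => oV; have [a [ap aV]] := oV p Vp.
by exists (specD a); [split=> //; exists a|exact: subset_trans VU].
Qed.

End SpecTopology.

(* [Spec T] equipped with the constructible topology. *)
Definition patchSpec (d : Order.disp_t) (T : tbDistrLatticeType d) : Type :=
  Spec T.

Section PatchTopology.
Context {d : Order.disp_t} {T : tbDistrLatticeType d}.

Definition patchDV (ab : T * T) : set (patchSpec T) :=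
  specD ab.1 `&` specV ab.2.

Lemma patchDV_cover (p : patchSpec T) : exists ab, patchDV ab p.
Proof.
exists (\top, \bot); split; first by rewrite specDT.
by rewrite /specV specD0.
Qed.

Lemma patchDV_meet (ab ab' : T * T) :
  exists ab'', patchDV ab'' = patchDV ab `&` patchDV ab'.
Proof.
exists ((ab.1 `&` ab'.1)%O, (ab.2 `|` ab'.2)%O).
by rewrite /patchDV /specV /= specDI specDU setCU setIACA.
Qed.

HB.instance Definition _ := Choice.copy (patchSpec T) (Spec T).
HB.instance Definition _ := isOpenTopological.Build (patchSpec T)
  (open_of_basisT patchDV_cover) (open_of_basisI patchDV_meet)
  (@open_of_basis_bigU _ _ patchDV).

Lemma open_patchDV : @open (patchSpec T) = open_of_basis patchDV.
Proof. by []. Qed.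

Lemma patchDV_basis : basis (range patchDV).
Proof.
split=> [_ [a _ <-]|p U]; first by rewrite open_patchDV => p ap; exists a; split=> // q.
rewrite nbhsE => -[V [+ Vp] VU]; rewrite open_patchDV => oV; have [a [ap aV]] := oV p Vp.
by exists (patchDV a); [split=> //; exists a|exact: subset_trans VU].
Qed.

End PatchTopology.

Definition Max (d : Order.disp_t) (T : tbDistrLatticeType d) : set (Spec T) :=
  [set p | maximal_ideal (spec_ideal p)].
Arguments Max {d} T.

(* The closure is taken in the constructible topology, but the type of [Jspec T]
   is [set (Spec T)]: as a space (through the coercion [set_type]) it carries
   the topology induced by the usual one. *)
Definition Jspec (d : Order.disp_t) (T : tbDistrLatticeType d) : set (Spec T) :=
  closure (Max T : set (patchSpec T)).
Arguments Jspec {d} T.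

Section SpecMap.
Context {d d' : Order.disp_t}.
Context {T : tbDistrLatticeType d} {T' : tbDistrLatticeType d'}.

Lemma prime_ideal_preimage (f : tbdlMorphism T T') (q : Spec T') :
  prime_ideal (f @^-1` spec_ideal q).
Proof.
case: q => q [[q0 qU qle] [q1 qI qge]]; split; split=> /=.
- by rewrite (omorph0 f).
- by move=> a b qa qb; rewrite (omorphU f); exact: qU.
- by move=> a b ab; apply: qle; exact: (omorph_le f).
- by rewrite (omorph1 f).
- by move=> a b qa qb; rewrite (omorphI f); exact: qI.
- by move=> a b ab; apply: qge; exact: (omorph_le f).
Qed.

Definition spec_map (f : tbdlMorphism T T') (q : Spec T') : Spec T :=
  MkSpec (prime_ideal_preimage f q).

End SpecMap.

Definition spectral_subspace (d : Order.disp_t) (T : tbDistrLatticeType d)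
    (X : set (Spec T)) : Prop :=
  exists (d' : Order.disp_t) (T' : tbDistrLatticeType d')
    (f : tbdlMorphism T T'), range f = setT /\ X = range (spec_map f).

Definition homeomorphism (X Y : topologicalType) (f : X -> Y) : Prop :=
  continuous f /\ exists g : Y -> X, [/\ cancel f g, cancel g f & continuous g].

Section HeitmannPreorder.
Context {d : Order.disp_t} {T : tbDistrLatticeType d}.
Implicit Types a b c : T.

Definition heitmann_J (b : T) : set T :=
  [set a | forall x : T, (a `|` x = \top -> b `|` x = \top)%O].

Definition heitmann_le (a b : T) : Prop := heitmann_J a `<=` heitmann_J b.

Lemma heitmann_leE a b : heitmann_le a b <-> heitmann_J b a.
Proof.
split=> [ab|ba c ca x /ca]; last exact: ba.
by apply: ab.
Qed.

Lemma heitmann_le_of_le a b : a <= b -> heitmann_le a b.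
Proof.
move=> ab; apply/heitmann_leE => x ax; apply/eqP.
by rewrite -le1x -ax leU2.
Qed.

Lemma heitmann_le_trans a b c :
  heitmann_le a b -> heitmann_le b c -> heitmann_le a c.
Proof. exact: subset_trans. Qed.

Lemma heitmann_le_meet a b c :
  heitmann_le c (a `&` b)%O <-> heitmann_le c a /\ heitmann_le c b.
Proof.
split=> [h|[/heitmann_leE ca /heitmann_leE cb]].
  by split; apply: (heitmann_le_trans h); apply: heitmann_le_of_le;
    rewrite ?leIl ?leIr.
by apply/heitmann_leE => x cx; rewrite joinIl (ca _ cx) (cb _ cx) meetxx.
Qed.

Lemma heitmann_le_join a b c :
  heitmann_le (a `|` b)%O c <-> heitmann_le a c /\ heitmann_le b c.
Proof.
split=> [h|[/heitmann_leE ac /heitmann_leE bc]].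
  by split; apply: heitmann_le_trans h; apply: heitmann_le_of_le;
    rewrite ?leUl ?leUr.
apply/heitmann_leE => x; rewrite -joinA => /ac; rewrite joinCA => /bc.
by rewrite joinA joinxx.
Qed.

Definition heitmann_eq : rel T :=
  [rel a b | `[< heitmann_le a b /\ heitmann_le b a >]].

Lemma heitmann_eq_refl : reflexive heitmann_eq.
Proof. by move=> a; apply/asboolP; split; exact: subset_refl. Qed.

Lemma heitmann_eq_sym : symmetric heitmann_eq.
Proof. by move=> a b; apply: asbool_equiv_eq; split=> -[]. Qed.

Lemma heitmann_eq_trans : transitive heitmann_eq.
Proof.
move=> b a c /asboolP[ab ba] /asboolP[bc cb]; apply/asboolP.
by split; [apply: heitmann_le_trans bc|apply: heitmann_le_trans ba].
Qed.

Canonical heitmann_equiv :=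
  EquivRel heitmann_eq heitmann_eq_refl heitmann_eq_sym heitmann_eq_trans.

End HeitmannPreorder.

Definition He (d : Order.disp_t) (T : tbDistrLatticeType d) : Type :=
  {eq_quot (@heitmann_equiv d T)}.

Section HeitmannLattice.
Context {d : Order.disp_t} {T : tbDistrLatticeType d}.

HB.instance Definition _ := Choice.on (He T).
HB.instance Definition _ := EqQuotient.on (He T).

Definition he_pi : T -> He T := \pi_(He T).

Lemma he_piP (a b : T) :
  he_pi a = he_pi b <-> heitmann_le a b /\ heitmann_le b a.
Proof. by split=> [/eqmodP/asboolP//|h]; apply/eqmodP/asboolP. Qed.

Lemma he_reprK : cancel (repr : He T -> T) he_pi.
Proof. by move=> x; rewrite /he_pi reprK. Qed.

Lemma he_pi_surj : range he_pi = setT.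
Proof. by apply/seteqP; split=> // x _; exists (repr x) => //; exact: he_reprK. Qed.

Definition he_le : rel (He T) :=
  [rel x y | `[< heitmann_le (repr x) (repr y) >]].
Definition he_meet (x y : He T) : He T := he_pi (repr x `&` repr y)%O.
Definition he_join (x y : He T) : He T := he_pi (repr x `|` repr y)%O.

Lemma he_lePi (a b : T) : he_le (he_pi a) (he_pi b) <-> heitmann_le a b.
Proof.
have /he_piP[a1 a2] := he_reprK (he_pi a).
have /he_piP[b1 b2] := he_reprK (he_pi b).
split=> [/asboolP h|h]; last apply/asboolP.
  exact: heitmann_le_trans a2 (heitmann_le_trans h b1).
exact: heitmann_le_trans a1 (heitmann_le_trans h b2).
Qed.

Lemma he_le_refl : reflexive he_le.
Proof. by move=> x; apply/asboolP; exact: subset_refl. Qed.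

Lemma he_le_anti : antisymmetric he_le.
Proof.
move=> x y /andP[/asboolP xy /asboolP yx].
by rewrite -(he_reprK x) -(he_reprK y); apply/he_piP.
Qed.

Lemma he_le_trans : transitive he_le.
Proof.
by move=> y x z /asboolP xy /asboolP yz; apply/asboolP; apply: subset_trans yz.
Qed.

HB.instance Definition _ :=
  Order.Le_isPOrder.Build d (He T) he_le_refl he_le_anti he_le_trans.

Lemma he_pi_le (a b : T) : he_pi a <= he_pi b <-> heitmann_le a b.
Proof. exact: he_lePi. Qed.

Lemma he_meetP (x y z : He T) : (x <= he_meet y z) = (x <= y) && (x <= z).
Proof.
rewrite /Order.le /= -(he_reprK x) -(he_reprK y) -(he_reprK z).
move: (repr x) (repr y) (repr z) => {x y z} a b c.
have /he_piP[b1 b2] := he_reprK (he_pi b).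
have /he_piP[c1 c2] := he_reprK (he_pi c).
apply/idP/andP.
  move=> /he_lePi/heitmann_le_meet[h1 h2].
  by split; apply/he_lePi; [apply: heitmann_le_trans b1
                           |apply: heitmann_le_trans c1].
move=> [/he_lePi h1 /he_lePi h2]; apply/he_lePi/heitmann_le_meet.
by split; [apply: heitmann_le_trans b2|apply: heitmann_le_trans c2].
Qed.

Lemma he_joinP (x y z : He T) : (he_join x y <= z) = (x <= z) && (y <= z).
Proof.
rewrite /Order.le /= -(he_reprK x) -(he_reprK y) -(he_reprK z).
move: (repr x) (repr y) (repr z) => {x y z} a b c.
have /he_piP[a1 a2] := he_reprK (he_pi a).
have /he_piP[b1 b2] := he_reprK (he_pi b).
apply/idP/andP.
  move=> /he_lePi/heitmann_le_join[h1 h2].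
  by split; apply/he_lePi; [apply: heitmann_le_trans h1
                           |apply: heitmann_le_trans h2].
move=> [/he_lePi h1 /he_lePi h2]; apply/he_lePi/heitmann_le_join.
by split; [apply: heitmann_le_trans h1|apply: heitmann_le_trans h2].
Qed.

HB.instance Definition _ :=
  Order.POrder_MeetJoin_isLattice.Build d (He T) he_meetP he_joinP.

Lemma he_pi_homo : {homo he_pi : a b / a <= b}.
Proof. by move=> a b ab; apply/he_pi_le/heitmann_le_of_le. Qed.

Lemma he_pi_meet : Order.meet_morphism he_pi.
Proof.
move=> a b; apply/le_anti/andP; split.
  by rewrite lexI !he_pi_homo ?leIl ?leIr.
rewrite -(he_reprK (_ `&` _)%O); apply/he_pi_le/heitmann_le_meet.
by split; apply/he_pi_le; rewrite he_reprK; [exact: leIl|exact: leIr].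
Qed.

Lemma he_pi_join : Order.join_morphism he_pi.
Proof.
move=> a b; apply/le_anti/andP; split; last first.
  by rewrite leUx !he_pi_homo ?leUl ?leUr.
rewrite -(he_reprK (_ `|` _)%O); apply/he_pi_le/heitmann_le_join.
by split; apply/he_pi_le; rewrite he_reprK; [exact: leUl|exact: leUr].
Qed.

Lemma he_meetUl :
  left_distributive (Order.meet : He T -> He T -> He T) Order.join.
Proof.
move=> x y z; rewrite -(he_reprK x) -(he_reprK y) -(he_reprK z).
by rewrite -he_pi_join -!he_pi_meet meetUl he_pi_join.
Qed.

HB.instance Definition _ :=
  Order.Lattice_Meet_isDistrLattice.Build d (He T) he_meetUl.

Lemma he_le0x (x : He T) : he_pi \bot <= x.
Proof. by rewrite -(he_reprK x) he_pi_homo. Qed.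

Lemma he_lex1 (x : He T) : x <= he_pi \top.
Proof. by rewrite -(he_reprK x) he_pi_homo. Qed.

HB.instance Definition _ := Order.hasBottom.Build d (He T) he_le0x.
HB.instance Definition _ := Order.hasTop.Build d (He T) he_lex1.

HB.instance Definition _ :=
  Order.isOrderMorphism.Build d T d (He T) he_pi he_pi_homo.
HB.instance Definition _ :=
  Order.isLatticeMorphism.Build d T d (He T) he_pi he_pi_meet he_pi_join.
HB.instance Definition _ :=
  Order.isBLatticeMorphism.Build d T d (He T) he_pi erefl.
HB.instance Definition _ :=
  Order.isTLatticeMorphism.Build d T d (He T) he_pi erefl.

End HeitmannLattice.

(* Main.v *)
Require Import Defs.
From HB Require Import structures.
From mathcomp Require Import all_boot all_order.
From mathcomp Require Import all_classical topology.

Set Implicit Arguments.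
Unset Strict Implicit.
Unset Printing Implicit Defensive.

Local Open Scope classical_set_scope.

(** Two observations carry the proof.

    The first is that, for a maximal ideal [m], [a] lies outside [m] exactly
    when some [x] in [m] satisfies [a `|` x = \top] ([maximal_ideal_cojoin]),
    and that every element other than [\top] lies in a maximal ideal
    ([exists_maximal]). Hence a maximal ideal that contains [b] and avoids [a]
    exists exactly when some [x] has [a `|` x = \top] and
    [b `|` x <> \top], that is, when [heitmann_le a b] fails
    ([heitmann_le_MaxP]).

    The second is that the constructible closure of a set [X] of primes
    consists of the primes [p] such that, for every [b] in [p] and [a] outside
    [p], some member of [X] contains [b] and avoids [a]. For [X = Max T] this
    says that [p] is downward closed for the Heitmann preorder ([JspecP]). For
    any quotient [f], the primes that are downward closed for the preorder
    [f a <= f b] are those that come from the quotient ([range_spec_mapP]), so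
    [Jspec T] is the image of [Spec (He T)]. Such an image is always
    homeomorphic to the spectrum of the quotient ([spec_map_homeo]). *)

Section MaximalIdeals.
Context {d : Order.disp_t} {T : tbDistrLatticeType d}.
Local Open Scope order_scope.
Import Order.TTheory.

Lemma ideal_proper (I : set T) : lattice_ideal I -> ~ I \top -> proper_ideal I.
Proof. by move=> idI nI1; split=> // IT; apply: nI1; rewrite IT. Qed.

Lemma proper_ideal_top (I : set T) : proper_ideal I -> ~ I \top.
Proof.
case=> -[_ _ dwI] nIT I1; apply: nIT; apply/seteqP; split=> // x _.
by apply: dwI I1; rewrite lex1.
Qed.

(** The ideal generated by [I] and [a], which is [I'] below, is strictly larger
    than [I], so it is not proper. *)
Lemma maximal_ideal_cojoin (I : set T) (a : T) :
  maximal_ideal I -> ~ I a -> exists2 x, I x & (a `|` x)%O = \top.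
Proof.
move=> [[[I0 IU Ile] nIT] Imax] nIa.
pose I' : set T := [set y | exists2 x, I x & (y <= a `|` x)%O].
have idI' : lattice_ideal I'.
  split=> [|y z [u Iu yu] [v Iv zv]|y z yz [u Iu zu]].
  - by exists \bot => //; rewrite le0x.
  - exists (u `|` v)%O; first exact: IU.
    have -> : (a `|` (u `|` v) = (a `|` u) `|` (a `|` v))%O.
      by rewrite joinACA joinxx.
    exact: leU2.
  - by exists u => //; exact: le_trans zu.
have [[x Ix ax]|nI'1] := pselect (I' \top).
  by exists x => //; apply/eqP; rewrite -le1x.
case: nIa; rewrite -(Imax I' (ideal_proper idI' nI'1)).
  by exists \bot => //; rewrite leUl.
by move=> x Ix; exists x => //; rewrite leUr.
Qed.

Lemma maximal_ideal_prime (I : set T) : maximal_ideal I -> prime_ideal I.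
Proof.
move=> mI; have nI1 := proper_ideal_top mI.1.
have [[[I0 IU Ile] _] _] := mI.
split=> //; split=> [//| |a b ba nIb Ia]; last first.
  by apply: nIb; apply: Ile Ia.
move=> a b /(maximal_ideal_cojoin mI)[x Ix ax].
move=> /(maximal_ideal_cojoin mI)[y Iy bY] Iab.
apply: nI1; suff <- : ((a `&` b) `|` (x `|` y))%O = \top.
  exact: IU Iab (IU _ _ Ix Iy).
by rewrite joinIl joinA ax join1x joinCA bY joinx1 meetxx.
Qed.

(** Zorn's lemma is applied to chains that may be empty, whose union is empty.
    The family [P] therefore asks for [I c] only when [I] is inhabited; a
    maximal member is inhabited because the principal ideal of [c] belongs to
    [P]. *)
Lemma exists_maximal (c : T) :
  c <> \top -> exists2 m : Spec T, Max T m & spec_ideal m c.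
Proof.
move=> c1.
pose P (I : set T) := [/\ ~ I \top,
  forall a b, I a -> I b -> I (a `|` b)%O,
  forall a b, a <= b -> I b -> I a & forall a, I a -> I c].
have [I [[nI1 IU Ile Ic] Imax]] : exists A, P A /\ forall B, A `<` B -> ~ P B.
  apply: Zorn_bigcup => F FP Ftot; split.
  - by case=> X /FP[].
  - move=> a b [X FX Xa] [Y FY Yb].
    have [XY|YX] := Ftot X Y FX FY.
      by exists Y => //; have [_ YU _ _] := FP Y FY; apply: YU => //; exact: XY.
    by exists X => //; have [_ XU _ _] := FP X FX; apply: XU => //; exact: YX.
  - by move=> a b ab [X FX Xb]; exists X => //; have [_ _ Xle _] := FP X FX;
      exact: Xle Xb.
  - by move=> a [X FX Xa]; exists X => //; have [_ _ _ XC] := FP X FX;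
      exact: XC Xa.
have Icc : I c.
  have [//|nIc] := pselect (I c); exfalso.
  apply: (Imax [set y | (y <= c)%O]).
    split; first by move=> x /Ic.
    by move=> /(_ c); rewrite /= lexx => /(_ isT).
  split=> /= [|a b ac bc|a b ab bc|a _].
  - by rewrite le1x => /eqP.
  - by rewrite leUx ac.
  - exact: le_trans bc.
  - by [].
have idI : lattice_ideal I by split=> //; apply: Ile Icc; rewrite le0x.
have mI : maximal_ideal I.
  split=> [|I' pI' II']; first exact: ideal_proper.
  have [[_ I'U I'le] _] := pI'.
  apply: contrapT => nII'; apply: (Imax I').
    by split=> // I'I; apply: nII'; apply/seteqP.
  by split=> //; [exact: proper_ideal_top|move=> _ _; exact: II'].
by exists (MkSpec (maximal_ideal_prime mI)).
Qed.

End MaximalIdeals.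

Section HeitmannPrimes.
Context {d : Order.disp_t} {T : tbDistrLatticeType d}.
Local Open Scope order_scope.
Import Order.TTheory.
Implicit Types (a b : T) (p m : Spec T).

(** When [a `|` x = \top] and [b `|` x <> \top], a maximal ideal containing
    [b `|` x] avoids [a]; conversely a maximal ideal separating [a] from [b]
    provides such an [x]. *)
Lemma heitmann_le_MaxP a b :
  specD a `&` Max T `<=` specD b `&` Max T <-> heitmann_le a b.
Proof.
split=> [h|/heitmann_leE Jab m [nma mm]].
  apply/heitmann_leE => x ax; apply: contrapT => /exists_maximal[m mm mbx].
  have [[_ mU mle] _] := spec_prime m.
  have [] : (specD b `&` Max T) m; last first.
    by case=> /=; apply: mle mbx; rewrite leUl.
  apply: h; split=> // ma; apply: (proper_ideal_top mm.1).
  by rewrite -ax; apply: mU => //; apply: mle mbx; rewrite leUr.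
split=> // mb; have [x mx ax] := maximal_ideal_cojoin mm nma.
have [[_ mU _] _] := spec_prime m.
by apply: (proper_ideal_top mm.1); rewrite -(Jab x ax); exact: mU.
Qed.

Lemma patch_closureP (X : set (patchSpec T)) (p : patchSpec T) :
  closure X p <-> forall a b, specD a p -> specV b p ->
    X `&` (specD a `&` specV b) !=set0.
Proof.
split=> [clp a b pa pb|h B].
  apply: clp; apply: open_nbhs_nbhs; split=> //; rewrite open_patchDV => q abq.
  by exists (a, b); split=> // r.
rewrite nbhsE => -[U [+ Up] UB]; rewrite open_patchDV => oU.
have [[a b] [[pa pb] abU]] := oU p Up.
by have [q [Xq abq]] := h a b pa pb; exists q; split=> //; apply/UB/abU.
Qed.

Lemma JspecP p :
  Jspec T p <->
  forall a b, heitmann_le a b -> spec_ideal p b -> spec_ideal p a.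
Proof.
split=> [/patch_closureP clp a b ab pb|h].
  apply: contrapT => pa; have npb : specV b p by move=> /(_ pb).
  have [m [mm [ma mb]]] := clp a b pa npb.
  by have [] := (heitmann_le_MaxP a b).2 ab m (conj ma mm).
apply/patch_closureP => a b pa /contrapT pb.
have : ~ heitmann_le a b by move=> /h/(_ pb).
move=> /heitmann_le_MaxP; apply: contra_notP => nX m [ma mm]; split=> // mb.
by apply: nX; exists m; split=> //; split=> // /(_ mb).
Qed.

End HeitmannPrimes.

Lemma continuous_specD (d : Order.disp_t) (T : tbDistrLatticeType d)
    (X : topologicalType) (g : X -> Spec T) :
  (forall a, open (g @^-1` specD a)) -> continuous g.
Proof.
move=> og; apply/continuousP => A; rewrite open_specD => oA.
rewrite (_ : g @^-1` A = \bigcup_(a in [set a | specD a `<=` A])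
    (g @^-1` specD a)).
  by apply: bigcup_open.
apply/seteqP; split=> [x /oA[a [ax aA]]|x [a aA]]; first by exists a.
exact: aA.
Qed.

Section QuotientSpectrum.
Context {d d' : Order.disp_t}.
Context {T : tbDistrLatticeType d} {T' : tbDistrLatticeType d'}.
Variable f : tbdlMorphism T T'.
Hypothesis f_surj : range f = setT.
Local Open Scope order_scope.
Import Order.TTheory.

Let f_preim (y : T') : exists a, f a = y.
Proof. by have [a _ fa] : range f y; [rewrite f_surj|exists a]. Qed.

Lemma spec_map_inj : injective (spec_map f).
Proof.
move=> q q' /(congr1 (@spec_ideal _ _)) /= qq'; apply: spec_eq.
apply/funext => y; have [a <-] := f_preim y.
exact: (congr1 (@^~ a) qq').
Qed.

(** The prime of the quotient above [p] is the direct image of [p], whose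
    inverse image is no larger than [p] because [p] is downward closed for the
    preorder that [f] induces. *)
Lemma range_spec_mapP (p : Spec T) :
  range (spec_map f) p <->
  forall a b, f a <= f b -> spec_ideal p b -> spec_ideal p a.
Proof.
split=> [[q _ <-] a b ab|h].
  by have [[_ _ qle] _] := spec_prime q; exact: qle.
have [[p0 pU ple] [p1 pI _]] := spec_prime p.
pose I := f @` spec_ideal p.
have IE a : I (f a) <-> spec_ideal p a.
  split=> [[b pb ba]|pa]; last by exists a.
  by apply: h pb; rewrite ba lexx.
have prI : prime_ideal I.
  split; split.
  - by rewrite -(omorph0 f); apply/IE.
  - move=> x y; have [a <-] := f_preim x; have [b <-] := f_preim y.
    by move=> /IE pa /IE pb; rewrite -(omorphU f); apply/IE; exact: pU.
  - move=> x y; have [a <-] := f_preim x; have [b <-] := f_preim y.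
    by move=> ab /IE pb; apply/IE; exact: h pb.
  - by rewrite -(omorph1 f) => /IE.
  - move=> x y; have [a <-] := f_preim x; have [b <-] := f_preim y.
    move=> na nb; rewrite -(omorphI f) => /IE.
    by apply: pI => [pa|pb]; [apply: na|apply: nb]; apply/IE.
  - move=> x y; have [a <-] := f_preim x; have [b <-] := f_preim y.
    by move=> ba nb /IE pa; apply: nb; apply/IE; exact: h pa.
exists (MkSpec prI) => //; apply: spec_eq; apply/seteqP.
by split=> a /IE.
Qed.

(** [spec_map f] is injective and identifies the basic open [specD (f a)] with the
    trace of [specD a] on its image; every basic open of [Spec T'] has the form
    [specD (f a)] because [f] is surjective. *)
Lemma spec_map_homeo (X : set (Spec T)) : X = range (spec_map f) ->
  exists h : Spec T' -> X,
    homeomorphism h /\ forall q, set_val (h q) = spec_map f q.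
Proof.
move=> XE.
have Xf q : X (spec_map f q) by rewrite XE; exists q.
pose h q : X := exist _ (spec_map f q) (mem_set (Xf q)).
have hE q : set_val (h q) = spec_map f q by [].
have val_injX : injective (set_val : X -> Spec T) by move=> x y /val_inj.
have /choice[g gE] (x : X) : exists q, spec_map f q = set_val x.
  have [q _ qx] : range (spec_map f) (\val x); last by exists q.
  by rewrite -XE; exact: set_valP.
exists h; split=> //; split.
  apply: continuous_comp_initial; apply: continuous_specD => a.
  by rewrite open_specD => q qa; exists (f a); split=> // r.
exists g; split.
- by move=> q; apply: spec_map_inj; rewrite gE.
- by move=> x; apply: val_injX; rewrite hE gE.
- apply: continuous_specD => y.
  have [a _ <-] : range f y by rewrite f_surj.
  exists (specD a); first by rewrite open_specD => p pa; exists a; split=> // r.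
  by apply/seteqP; split=> x; rewrite /= /specD /= -gE.
Qed.

End QuotientSpectrum.

Theorem mainTheorem1 (d : Order.disp_t) (T : tbDistrLatticeType d) :
  [/\ spectral_subspace (Jspec T),
      exists h : Spec (He T) -> Jspec T,
        homeomorphism h /\
        forall q : Spec (He T), set_val (h q) = spec_map he_pi q
    & forall a b : T,
        specD a `&` Max T `<=` specD b `&` Max T <-> heitmann_le a b].
Proof.
have JE : Jspec T = range (spec_map (he_pi : tbdlMorphism T (He T))).
  apply/seteqP; split=> p.
    move=> /JspecP h; apply/(range_spec_mapP he_pi_surj) => a b /he_pi_le.
    exact: h.
  move=> /(range_spec_mapP he_pi_surj) h; apply/JspecP => a b /he_pi_le.
  exact: h.
split; last exact: heitmann_le_MaxP.
- by exists d, (He T), he_pi; split=> //; exact: he_pi_surj.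
- by have := spec_map_homeo he_pi_surj JE.
Qed.
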